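(* Let $N\ge 2$ and let $\xi_1,\dots,\xi_N$ be complex numbers with $0<|\xi_i|<1$. For $\sigma\in S_N$ let $\mathbf{A}_\sigma$ be the $2^N\times 2^N$ matrix defined in the context, and let $[\mathbf{A}_\sigma]$ denote its $(2^{N-1}+1,\,2^{N-1}+1)$ entry. Then for every $\sigma\in S_N$, $$[\mathbf{A}_\sigma]=\operatorname{sgn}(\sigma)\prod_{i=0}^{N-2}\left(\frac{1-\xi_{2+i}}{1-\xi_{\sigma(2+i)}}\right)^i.$$
   Context: For distinct $\alpha,\beta\in\{1,\dots,N\}$ put $$\mathbf{S}_{\beta\alpha}=\begin{bmatrix}-\frac{1-\xi_\beta}{1-\xi_\alpha}&0&0&0\\0&-\frac{1-\xi_\beta}{1-\xi_\alpha}&\frac{\xi_\beta-\xi_\alpha}{1-\xi_\alpha}&0\\0&0&-1&0\\0&0&0&-\frac{1-\xi_\beta}{1-\xi_\alpha}\end{bmatrix}.$$ For $l=1,\dots,N-1$ define the $2^N\times2^N$ matrix $\mathbf{T}_l(\alpha,\beta)=\mathbf{I}_2^{\otimes(l-1)}\otimes\mathbf{S}_{\beta\alpha}\otimes\mathbf{I}_2^{\otimes(N-l-1)}$, where $\mathbf{I}_2$ is the $2\times2$ identity matrix and $\otimes$ is the Kronecker (tensor) product with the standard ordering (the basis of the tensor product is indexed by words in $\{1,2\}$ of length $N$ listed in the order $1\cdots11,\,1\cdots12,\,1\cdots21,\dots,2\cdots2$, so that $21\cdots1$ has index $2^{N-1}+1$). Permutations $\sigma\in S_N$ are written as words $\sigma(1)\cdots\sigma(N)$.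 For $i=1,\dots,N-1$, $T_i$ acts on $\sigma$ by interchanging the entries in positions $i$ and $i+1$: $(T_i\sigma)(i)=\sigma(i+1)$, $(T_i\sigma)(i+1)=\sigma(i)$, and $(T_i\sigma)(k)=\sigma(k)$ for $k\ne i,i+1$. Any $\sigma$ can be written $\sigma=T_{a_n}\cdots T_{a_1}$, meaning that $\sigma$ is obtained from the identity word $12\cdots N$ by applying $T_{a_1}$, then $T_{a_2}$, and so on. Given such an expression, define $\mathbf{A}_\sigma=\mathbf{T}_{a_n}\cdots\mathbf{T}_{a_1}$, where $\mathbf{T}_{a_k}=\mathbf{T}_{a_k}(\alpha,\beta)$ with $\alpha$ and $\beta$ the entries in positions $a_k$ and $a_k+1$, respectively, of the word $T_{a_{k-1}}\cdots T_{a_1}(12\cdots N)$ (i.e. $T_{a_k}$ turns $\cdots\alpha\beta\cdots$ into $\cdots\beta\alpha\cdots$); $\mathbf{A}_\sigma$ is the identity matrix for the identity permutation. The matrix $\mathbf{A}_\sigma$ does not depend on the chosen expression of $\sigma$. *)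

(* Defs.v *)
From HB Require Import structures.
From mathcomp Require Import all_boot all_order all_fingroup all_algebra.
From mathcomp Require Import complex mxtens.
From mathcomp Require Import reals.

Set Implicit Arguments.
Unset Strict Implicit.
Unset Printing Implicit Defensive.

Import Order.TTheory GRing.Theory Num.Theory.
Local Open Scope ring_scope.

(* All indices are 0-based: xi i, sigma i, l and matrix indices stand for
   xi_{i+1}, sigma(i+1) - 1, l + 1 and so on in the usual 1-based notation. *)

Section Positions.

Variable N : nat.

Lemma posR_subproof (l : 'I_N.-1) : (l.+1 < N)%N.
Proof. by case: N l => [|n] [l]. Qed.

Definition posL (l : 'I_N.-1) : 'I_N := widen_ord (leq_pred N) l.
Definition posR (l : 'I_N.-1) : 'I_N := Ordinal (posR_subproof l).

(* A permutation sigma is read as the word sigma 0, ..., sigma N.-1. In 'S_N,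
   (t * sigma) k = sigma (t k), so multiplying on the left by a transposition
   swaps the entries in the two given positions. *)
Definition swapT (l : 'I_N.-1) (sigma : 'S_N) : 'S_N :=
  (tperm (posL l) (posR l) * sigma)%g.

(* The expression T_{a_n} ... T_{a_1} is the sequence [:: a_n; ...; a_1], in the
   order in which it is written: the last letter of the sequence acts first. *)
Definition expr_perm (a : seq 'I_N.-1) : 'S_N := foldr swapT 1%g a.

Lemma swapT_posL l sigma : swapT l sigma (posL l) = sigma (posR l).
Proof. by rewrite permM tpermL. Qed.

Lemma swapT_posR l sigma : swapT l sigma (posR l) = sigma (posL l).
Proof. by rewrite permM tpermR. Qed.

Lemma swapT_other l sigma k :
  k != posL l -> k != posR l -> swapT l sigma k = sigma k.
Proof. by move=> hL hR; rewrite permM tpermD // eq_sym. Qed.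

Lemma expr_perm_cat a b : expr_perm (a ++ b) = (expr_perm a * expr_perm b)%g.
Proof.
elim: a => [|l a IHa] /=; first by rewrite mul1g.
by rewrite IHa /swapT mulgA.
Qed.

Lemma expr_perm_tperm (i j : 'I_N) :
  (i < j)%N -> exists a, expr_perm a = tperm i j.
Proof.
case: j => j hj /=; elim: j hj => // j IHj hj hij.
have hl : (j < N.-1)%N by case: N hj.
pose l := Ordinal hl; have hj' : (j < N)%N by apply: ltnW.
have eL : posL l = Ordinal hj' by apply: val_inj.
have eR : posR l = Ordinal hj by apply: val_inj.
have el : expr_perm [:: l] = tperm (Ordinal hj') (Ordinal hj).
  by rewrite /expr_perm /= /swapT mulg1 eL eR.
case: (ltngtP i j) => [lt_ij||eq_ij]; last 2 first.
- by rewrite ltnNge -ltnS hij.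
- by exists [:: l]; rewrite el; congr tperm; apply: val_inj.
have [a ea] := IHj hj' lt_ij.
exists ([:: l] ++ a ++ [:: l]); rewrite !expr_perm_cat el ea.
rewrite -{1}(tpermV (Ordinal hj') (Ordinal hj)) -/(conjg _ _) tpermJ tpermL.
by rewrite tpermD // -val_eqE /= ?gtn_eqF.
Qed.

Lemma expr_perm_surj (sigma : 'S_N) : exists a, expr_perm a = sigma.
Proof.
have [ts -> _] := prod_tpermP sigma.
elim: ts => [|[i j] ts [a ea]]; first by exists [::]; rewrite big_nil.
rewrite big_cons /=; suff [b eb] : exists b, expr_perm b = tperm i j.
  by exists (b ++ a); rewrite expr_perm_cat eb ea.
case: (ltngtP i j) => [||/val_inj ->]; first exact: expr_perm_tperm.
  by rewrite tpermC; apply: expr_perm_tperm.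
by exists [::]; rewrite tperm1.
Qed.

End Positions.

Section Matrices.

Variables (F : fieldType) (N : nat) (xi : 'I_N -> F).

Definition Smx (beta alpha : 'I_N) : 'M[F]_4 :=
  let d := - ((1 - xi beta) / (1 - xi alpha)) in
  let c := (xi beta - xi alpha) / (1 - xi alpha) in
  \matrix_(i < 4, j < 4)
    nth 0 (nth [::] [:: [:: d; 0;   0; 0];
                        [:: 0; d;   c; 0];
                        [:: 0; 0; - 1; 0];
                        [:: 0; 0;   0; d]] i) j.

Lemma tens_dim (l : 'I_N.-1) : (2 ^ l * 4 * 2 ^ (N - l - 2) = 2 ^ N)%N.
Proof.
have hl := posR_subproof l.
by rewrite -[4%N]/(2 ^ 2)%N -!expnD -subnDA subnKC // addn2.
Qed.

(* The Kronecker product *t sends the pair of indices (i, j) to i * n + j, hence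
   orders words lexicographically; castmx only transports along tens_dim. *)
Definition Tmx (l : 'I_N.-1) (alpha beta : 'I_N) : 'M[F]_(2 ^ N) :=
  castmx (tens_dim l, tens_dim l)
    ((1%:M : 'M[F]_2) ^t l *t Smx beta alpha
       *t (1%:M : 'M[F]_2) ^t (N - l - 2)).

(* The matrix A_sigma computed from the expression a of sigma = expr_perm a. *)
Fixpoint Amx (a : seq 'I_N.-1) : 'M[F]_(2 ^ N) :=
  if a is l :: a' then
    Tmx l (expr_perm a' (posL l)) (expr_perm a' (posR l)) *m Amx a'
  else 1%:M.

End Matrices.

Lemma idx21_subproof N : (1 < N)%N -> (2 ^ N.-1 < 2 ^ N)%N.
Proof. by move=> hN; rewrite ltn_exp2l // prednK // ltnW. Qed.

(* The index of the word 21...1, which is 2 ^ (N - 1) + 1 in 1-based notation. *)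
Definition idx21 N (hN : (1 < N)%N) : 'I_(2 ^ N) := Ordinal (idx21_subproof hN).

(* Main.v *)
Require Import Defs.
From HB Require Import structures.
From mathcomp Require Import all_boot all_order all_fingroup all_algebra.
From mathcomp Require Import complex mxtens.
From mathcomp Require Import reals ring.

Set Implicit Arguments.
Unset Strict Implicit.
Unset Printing Implicit Defensive.

Import Order.TTheory GRing.Theory Num.Theory.
Local Open Scope ring_scope.

(** The dual basis vector of the word 21...1 is a left eigenvector of every
    T_l(alpha, beta), with eigenvalue -1 when l acts on the first two positions
    and -(1 - xi_beta)/(1 - xi_alpha) otherwise. Hence [A_sigma] is a product of
    eigenvalues. A swap changes the sign of sigma and exchanges two adjacent
    factors of prod_k (1 - xi_(sigma k))^(k-1) (positions counted from 0, the
    exponent at position 0 being 0), so the product telescopes. *)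

(* Row i of A is c times the i-th row of the identity. The index i is a bare
   natural number so that it can be moved along dimension casts. *)
Definition scalar_row (R : pzRingType) n (A : 'M[R]_n) (i : nat) (c : R) :=
  forall r s : 'I_n, r = i :> nat -> A r s = c *+ (r == s).

(** Entries of a Kronecker product are products of entries; since [k < n], division by [n] recovers
    [i] and [k] from the row index [i * n + k]. *)
Lemma scalar_row_tens (R : pzRingType) m n (A : 'M[R]_m) (B : 'M[R]_n) i k a b :
  (k < n)%N -> scalar_row A i a -> scalar_row B k b ->
  scalar_row (A *t B) (i * n + k) (a * b).
Proof.
move=> ltkn hA hB r s.
case: (mxtens_indexP r) => r1 r2; case: (mxtens_indexP s) => s1 s2 er.
have n_gt0 : (0 < n)%N by apply: leq_ltn_trans ltkn.
have /= e1 := congr1 (divn^~ n) er; have /= e2 := congr1 (modn^~ n) er.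
rewrite !divnMDl // !divn_small // !addn0 in e1.
rewrite !modnMDl !modn_small // in e2.
rewrite tensmxE (hA _ _ e1) (hB _ _ e2) (can_eq (@mxtens_indexK m n)) xpair_eqE.
by case: (r1 == s1); case: (r2 == s2); rewrite ?mulr1n ?mulr0n ?(mul0r, mulr0).
Qed.

Lemma scalar_row_cast (R : pzRingType) m n (e : m = n) (A : 'M[R]_m) i c :
  scalar_row A i c -> scalar_row (castmx (e, e) A) i c.
Proof. by move: (e); rewrite -e => e'; rewrite castmx_id. Qed.

Lemma ntensmx_1 (R : pzRingType) d k : (1%:M : 'M[R]_d) ^t k = 1%:M.
Proof.
have tens11 m n : (1%:M : 'M[R]_m) *t (1%:M : 'M[R]_n) = 1%:M.
  apply/matrixP=> r s.
  case: (mxtens_indexP r) => r1 r2; case: (mxtens_indexP s) => s1 s2.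
  rewrite tensmxE !mxE (can_eq (@mxtens_indexK m n)) xpair_eqE.
  by case: (r1 == s1); case: (r2 == s2); rewrite ?(mul0r, mulr0) ?mulr1.
(* The Kronecker power unfolds only from exponent 2 on, so 0 and 1 are base cases. *)
by case: k => // k; elim: k => // k IHk; rewrite ntensmxSS IHk tens11.
Qed.

Lemma scalar_row_1 (R : pzRingType) n i : scalar_row (1%:M : 'M[R]_n) i 1.
Proof. by move=> r s _; rewrite mxE. Qed.

Section Eigenvalue.

Variables (F : fieldType) (N : nat) (xi : 'I_N -> F).

Definition Teig (l : 'I_N.-1) (alpha beta : 'I_N) : F :=
  - ((1 - xi beta) / (1 - xi alpha)) ^+ (0 < l)%N.

Lemma scalar_row_Tmx l alpha beta :
  scalar_row (Tmx xi l alpha beta) (2 ^ N.-1) (Teig l alpha beta).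
Proof.
apply: scalar_row_cast; rewrite !ntensmx_1.
have hl := posR_subproof l.
(* The word 21...1 is cut into its first [l] letters, the two letters on which [Smx] acts, and the
   rest, with indices [i], [j] and 0. The middle block is 21, of index 2, exactly when [l] is 0. *)
pose i := if (l : nat) is k.+1 then (2 ^ k)%N else 0%N.
pose j := if (l : nat) is _.+1 then 0%N else 2%N.
have -> : (2 ^ N.-1 = (i * 4 + j) * 2 ^ (N - l - 2) + 0)%N.
  rewrite /i /j; case: (l : nat) hl => [|k] hl.
    by rewrite mul0n add0n addn0 subn0 -expnS -subSn // subn2.
  rewrite !addn0 -[4%N]/(2 ^ 2)%N -!expnD; congr (2 ^ _)%N.
  by case: (N) hl => // n hl; rewrite -subnDA addSn subSS subnKC ?addn2.
rewrite -[Teig _ _ _]mulr1 -{1}[Teig _ _ _]mul1r.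
apply: scalar_row_tens; [by rewrite expn_gt0 | | exact: scalar_row_1].
apply: scalar_row_tens; [by rewrite /j; case: (l : nat) | exact: scalar_row_1 |].
move=> r s er; rewrite mxE er /j /Teig; move: er; rewrite /j.
case: (l : nat) => [|k] er; rewrite -val_eqE /= er ?expr0 ?expr1.
  by case: s => [[|[|[|[|]]]] ?].
by case: s => [[|[|[|[|]]]] ?].
Qed.

Definition weight (sigma : 'S_N) : F :=
  \prod_(k < N) (1 - xi (sigma k)) ^+ k.-1.

Hypothesis xi_neq1 : forall i, 1 - xi i != 0.

Lemma weight_neq0 sigma : weight sigma != 0.
Proof. by apply/prodf_neq0 => i _; apply: expf_neq0. Qed.

Lemma posL_neq_posR (l : 'I_N.-1) : posL l != posR l.
Proof. by rewrite -val_eqE /= neq_ltn leqnn. Qed.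

(** The exchanged positions carry exponents [l.-1] and [l]. These differ by one unless [l] is 0,
    when truncation makes both 0 and the weight is unchanged. *)
Lemma weight_swapT l (sigma : 'S_N) :
  weight (swapT l sigma) * (1 - xi (sigma (posR l))) ^+ (0 < l)%N =
  weight sigma * (1 - xi (sigma (posL l))) ^+ (0 < l)%N.
Proof.
have neqRL : posR l != posL l by rewrite eq_sym posL_neq_posR.
have splitw rho : weight rho =
    (1 - xi (rho (posL l))) ^+ l.-1 * ((1 - xi (rho (posR l))) ^+ l *
    \prod_(k < N | (k != posL l) && (k != posR l)) (1 - xi (rho k)) ^+ k.-1).
  by rewrite /weight (bigD1 (posL l)) // (bigD1 (posR l)).
rewrite !splitw swapT_posL swapT_posR.
under eq_bigr => k /andP[hL hR] do rewrite swapT_other //.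
case: (l : nat) => [|k] /=; first by rewrite !expr0.
by rewrite !expr1 !exprS; ring.
Qed.

Lemma scalar_row_Amx (a : seq 'I_N.-1) :
  scalar_row (Amx xi a) (2 ^ N.-1)
    ((-1) ^+ expr_perm a * (weight 1 / weight (expr_perm a))).
Proof.
elim: a => [|l a IHa] r s er /=.
  by rewrite odd_perm1 expr0 mul1r divff ?weight_neq0 // mxE.
(* Row [r] of the left factor vanishes off the diagonal, so only [k = r] survives. *)
rewrite mxE (bigD1 r) //= big1 ?addr0 => [|k neq_kr]; last first.
  by rewrite (scalar_row_Tmx _ _ _ _ er) eq_sym (negPf neq_kr) mul0r.
rewrite (scalar_row_Tmx _ _ _ _ er) eqxx mulr1n (IHa _ _ er) mulrnAr.
congr (_ *+ _); set tau := expr_perm a; have := weight_swapT l tau.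
rewrite odd_permM odd_tperm posL_neq_posR signr_addb -/(swapT l tau) /Teig.
rewrite expr1 exprMn exprVn => ew.
have wn := weight_neq0 tau; have wn' := weight_neq0 (swapT l tau).
have xn := expf_neq0 (0 < l)%N (xi_neq1 (tau (posL l))).
move: (_ ^+ (0 < l)%N) (_ ^+ (0 < l)%N) ew wn wn' xn => x y ew wn wn' xn.
rewrite mulN1r !mulNr; congr (- _); rewrite mulrCA; congr (_ * _).
(* Multiplying by the weight of [swapT l tau] leaves the exchange identity [ew]. *)
rewrite mulrCA; congr (_ * _); apply: (mulfI wn').
by rewrite !mulrA ew mulfK // !divff.
Qed.

End Eigenvalue.

Theorem lemma3p3 (R : realType) (N : nat) (hN : (1 < N)%N) (xi : 'I_N -> R[i])
    (hxi : forall i : 'I_N, 0 < `|xi i| < 1)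
    (sigma : 'S_N) (a : seq 'I_N.-1) (ha : expr_perm a = sigma) :
  Amx xi a (idx21 hN) (idx21 hN) =
    (-1) ^+ sigma *
    \prod_(i < N.-1) ((1 - xi (posR i)) / (1 - xi (sigma (posR i)))) ^+ i.
Proof.
have xi_neq1 i : 1 - xi i != 0.
  rewrite subr_eq0; apply/eqP=> e; have /andP[_] := hxi i.
  by rewrite -e normr1 ltxx.
rewrite (scalar_row_Amx xi_neq1) // eqxx mulr1n ha /weight -prodf_div.
congr (_ * _); case: N hN xi sigma {hxi a ha xi_neq1} => // n _ xi sigma.
(* Position 0 has exponent 0 and drops out; position [i.+1] has exponent [i]. *)
rewrite big_ord_recl expr0 !divr1 mul1r; apply: eq_bigr => i _.
have -> : posR (i : 'I_n.+1.-1) = lift ord0 i by apply: val_inj.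
by rewrite perm1 expr_div_n.
Qed.
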